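(* For all integers $r\ge2$, $s\ge0$, $k\ge2$ there exist $\alpha=\alpha(r,s,k)\in\mathbb{R}$ and $\beta=\beta(r,s)\in\mathbb{N}$ such that for every finite $r$-grid $B$ and every $K_{k,\dots,k}$-free subset $A\subseteq B$ of grid-complexity $s$, $$|A|\le\alpha\,\delta^r_{r-1}(B)\log^\beta\big(\delta^r_{r-1}(B)+1\big).$$ Moreover, one can take $\beta(r,s)=s(2^{r-1}-1)$.
   Context: An $r$-grid is a Cartesian product $B=B_1\times\dots\times B_r$; a sub-grid is $C_1\times\dots\times C_r$ with $C_i\subseteq B_i$. For $i\in[r]$ let $B^i=\prod_{j\neq i}B_j$ and for $a\in B^i$, $b\in B_i$ let $a\oplus_i b\in B$ be the element with $i$-th coordinate $b$ and other coordinates given by $a$. For a linear order $(S,<)$, $f\colon B\to S$ is coordinate-wise monotone if for all $i$, $a,a'\in B^i$, $b,b'\in B_i$: $f(a\oplus_i b)\le f(a\oplus_i b')\iff f(a'\oplus_i b)\le f(a'\oplus_i b')$. A subset $X\subseteq B$ is basic if $X=\{b\in B:f(b)<l\}$ for some linear order $S$, coordinate-wise monotone $f\colon B\to S$ and $l\in S$. A set $A\subseteq B$ has grid-complexity $s$ if $A$ is the intersection of $B$ with at most $s$ basic subsets of $B$. $A$ is $K_{k,\dots,k}$-free if it contains no sub-grid $C_1\times\dots\times C_r$ with $|C_i|=k$ for all $i$. For a finite grid with $n_i=|B_i|$, $\delta^r_{j}(B)=\sum_{i_1<\dots<i_j\in[r]}n_{i_1}\cdots n_{i_j}$. *)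

(* Defs.v *)
From HB Require Import structures.
From mathcomp Require Import all_boot all_order all_algebra.
From mathcomp Require Import reals exp.

Set Implicit Arguments.
Unset Strict Implicit.
Unset Printing Implicit Defensive.

Section Grid.
Variables (r : nat) (B : 'I_r -> finType).

Definition grid := {dffun forall i : 'I_r, B i}.

Definition grid_del (i : 'I_r) :=
  {dffun forall j : {j : 'I_r | j != i}, B (val j)}.

Definition oplus (i : 'I_r) (a : grid_del i) (b : B i) : grid :=
  finfun (fun j : 'I_r =>
    match eqVneq j i with
    | EqNotNeq e => ecast x (B x) (esym e) b
    | NeqNotEq ne => a (exist _ j ne)
    end).

Lemma oplus_same (i : 'I_r) (a : grid_del i) (b : B i) : oplus a b i = b.
Proof.
rewrite /oplus ffunE; case: eqVneq => [e|ne].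
  by rewrite (eq_axiomK e).
by exfalso; move: ne; rewrite eqxx.
Qed.

Lemma oplus_other (i : 'I_r) (a : grid_del i) (b : B i)
    (j : {j : 'I_r | j != i}) : oplus a b (val j) = a j.
Proof.
case: j => j ne /=; rewrite /oplus ffunE; case: eqVneq => [e|ne'].
  by exfalso; move: (ne); rewrite e eqxx.
by congr (a (exist _ j _)); apply: eq_irrelevance.
Qed.

Definition coordwise_monotone (d : Order.disp_t) (S : orderType d)
    (f : grid -> S) : Prop :=
  forall (i : 'I_r) (a a' : grid_del i) (b b' : B i),
    (f (oplus a b) <= f (oplus a b'))%O <->
    (f (oplus a' b) <= f (oplus a' b'))%O.

Definition basic (X : {set grid}) : Prop :=
  exists (d : Order.disp_t) (S : orderType d) (f : grid -> S) (l : S),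
    coordwise_monotone f /\ X = [set b : grid | (f b < l)%O].

(* The empty intersection (m = 0) is the whole grid. *)
Definition has_grid_complexity (s : nat) (A : {set grid}) : Prop :=
  exists (m : nat) (X : 'I_m -> {set grid}),
    [/\ m <= s, forall t, basic (X t) & A = \bigcap_(t < m) X t].

Definition K_free (k : nat) (A : {set grid}) : Prop :=
  ~ exists C : forall i : 'I_r, {set B i},
      (forall i, #|C i| = k) /\ setXn C \subset A.

Definition delta (j : nat) : nat :=
  \sum_(I : {set 'I_r} | #|I| == j) \prod_(i in I) #|B i|.

End Grid.

(* Main.v *)
Require Import Defs.
From HB Require Import structures.
From mathcomp Require Import all_boot all_order all_algebra.
From mathcomp Require Import zify.
From mathcomp Require Import reals exp.
Import Order.TTheory GRing.Theory Num.Theory.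

Set Implicit Arguments.
Unset Strict Implicit.
Unset Printing Implicit Defensive.

(** A coordinate-wise monotone [f] induces a total preorder on each factor for
    which [{f < l}] is a downset of the product; only this is used.  Sets of
    complexity [s] are bounded by induction on the dimension [r], for sets cut
    out of [I x D], where [I] lies in one factor and [D] in the product of the
    others, by [s1] downsets of the whole grid, [D] itself being an
    intersection of [s2] downsets.
    If [s1 = 0], the set is [I x D], so either [I] has fewer than [k] elements
    or [D] is [K]-free in dimension [r - 1].  If [s1 > 0], split [I] at its
    median [h] for the preorder of one of the [s1] downsets [X], and [D] into
    the fiber [Y] of [X] over [h] and its complement: [X] contains
    [lower half x Y], misses [upper half x complement of Y], and the two
    remaining pieces are treated recursively.  One of the [s1] constraints is
    thus traded for two constraints on [D] and one logarithm, which gives the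
    exponent [beta(r, s) = s + beta(r - 1, 2 s)], with [beta(1, s) = 0]. *)

(** * Grids as nested pairs, downsets and boxes *)

Definition btail r (B : 'I_r.+1 -> finType) : 'I_r -> finType :=
  fun i => B (lift ord0 i).

(** Nested pairs let the first factor split off by computation, as the induction on the dimension
    requires. *)
Fixpoint prodgrid r : ('I_r -> finType) -> finType :=
  match r with
  | 0 => fun _ => unit : finType
  | r'.+1 => fun B => (B ord0 * prodgrid (btail B))%type : finType
  end.

Fixpoint prod_rel r : forall B : 'I_r -> finType,
    (forall i, rel (B i)) -> rel (prodgrid B) :=
  match r with
  | 0 => fun _ _ _ _ => true
  | r'.+1 => fun B l p q =>
      l ord0 p.1 q.1 &&
      @prod_rel r' (btail B) (fun i => l (lift ord0 i)) p.2 q.2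
  end.

(** The preorders are chosen for each [X] separately: two basic sets may order the same factor
    differently. *)
Definition is_downset r (B : 'I_r -> finType) (X : {set prodgrid B}) : Prop :=
  exists l : forall i, rel (B i),
    (forall i, total (l i) /\ transitive (l i)) /\
    (forall p q, prod_rel l p q -> q \in X -> p \in X).

Fixpoint downset_complexity r (B : 'I_r -> finType) s (A : {set prodgrid B})
    : Prop :=
  match s with
  | 0 => A = setT
  | s'.+1 => exists A' X : {set prodgrid B},
      [/\ downset_complexity s' A', is_downset X & A = A' :&: X]
  end.

Definition slab r (B : 'I_r.+1 -> finType) (I : {set B ord0})
    (D : {set prodgrid (btail B)}) : {set prodgrid B} := setX I D.
Arguments slab {r} B I D.

Lemma in_slab r (B : 'I_r.+1 -> finType) I D (p : prodgrid B) :
  (p \in slab B I D) = (p.1 \in I) && (p.2 \in D).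
Proof. by rewrite /slab /= inE. Qed.

Lemma card_slab r (B : 'I_r.+1 -> finType) I D : #|slab B I D| = #|I| * #|D|.
Proof. exact: cardsX. Qed.

Fixpoint is_kbox k r : forall B : 'I_r -> finType, {set prodgrid B} -> Prop :=
  match r with
  | 0 => fun _ X => X = setT
  | r'.+1 => fun B X =>
      exists (C : {set B ord0}) (X' : {set prodgrid (btail B)}),
      [/\ #|C| = k, is_kbox k X' & X = slab B C X']
  end.

Definition kbox_free k r (B : 'I_r -> finType) (A : {set prodgrid B}) : Prop :=
  forall X, is_kbox k X -> ~~ (X \subset A).

(** The elementary symmetric polynomial behind [delta B (r - 1)], split according to whether the
    omitted factor is the first one. *)
Fixpoint codim1_sum r : ('I_r -> finType) -> nat :=
  match r with
  | 0 => fun _ => 0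
  | r'.+1 => fun B =>
      #|prodgrid (btail B)| + #|B ord0| * codim1_sum (btail B)
  end.

Section ProdGrid.
Variables (r : nat) (B : 'I_r -> finType).
Implicit Types A X : {set prodgrid B}.

Lemma kbox_freeS k A A' : A' \subset A -> kbox_free k A -> kbox_free k A'.
Proof.
by move=> sA fA X /fA; apply: contra => sX; apply: subset_trans sX sA.
Qed.

Lemma is_downset_setT : is_downset [set: prodgrid B].
Proof. by exists (fun _ _ _ => true); split=> [i|p q _]; rewrite ?inE. Qed.

Lemma downset_complexity_leq s s' A :
  s <= s' -> downset_complexity s A -> downset_complexity s' A.
Proof.
move=> /subnK <-; elim: (s' - s) => //= d IH /IH cA.
exists A, setT; split=> //; [exact: is_downset_setT | by rewrite setIT].
Qed.

Lemma downset_complexityI s A X :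
  downset_complexity s A -> is_downset X -> downset_complexity s.+1 (A :&: X).
Proof. by move=> cA dX; exists A, X. Qed.

End ProdGrid.

Lemma prod_rel_refl r (B : 'I_r -> finType) (l : forall i, rel (B i)) :
  (forall i, total (l i)) -> reflexive (prod_rel l).
Proof.
elim: r B l => //= r IH B l tl p.
have := tl ord0 p.1 p.1; rewrite orbb => -> /=.
by apply: IH => i; apply: tl.
Qed.

Lemma prod_rel_trans r (B : 'I_r -> finType) (l : forall i, rel (B i)) :
  (forall i, transitive (l i)) -> transitive (prod_rel l).
Proof.
elim: r B l => //= r IH B l tl q p t /andP[l1 g1] /andP[l2 g2].
rewrite (tl _ _ _ _ l1 l2) /=; apply: IH g1 g2 => i; exact: tl.
Qed.

(** Reversing every preorder turns an upset into a downset. *)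
Lemma is_downset_setC r (B : 'I_r -> finType) (X : {set prodgrid B}) :
  is_downset X -> is_downset (~: X).
Proof.
case=> l [tl dX]; exists (fun i x y => l i y x); split=> [i|p q].
  have [tot tr] := tl i; split=> [x y|y x z lyx lzy]; first exact: tot.
  exact: tr lzy lyx.
rewrite !inE => gpq; apply: contra; apply: dX.
elim: r B l p q gpq {X tl} => //= r IH B l p q /andP[-> /IH]; exact.
Qed.

Lemma is_downset_fiber r (B : 'I_r.+1 -> finType) (X : {set prodgrid B})
    (l : forall i, rel (B i)) (h : B ord0) :
  (forall i, total (l i) /\ transitive (l i)) ->
  (forall p q, prod_rel l p q -> q \in X -> p \in X) ->
  is_downset [set a : prodgrid (btail B) | (h, a) \in X].
Proof.
move=> tl dX; exists (fun i => l (lift ord0 i)); split=> [i|p q gpq].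
  exact: tl.
rewrite !inE; apply: dX => /=; rewrite gpq andbT.
by have [tot _] := tl ord0; have := tot h h; rewrite orbb.
Qed.

(** * Bisection of one factor along a downset *)

Section DyadicSplit.
Variables (r : nat) (B : 'I_r.+1 -> finType) (k s2 : nat).
Variables (X E : {set prodgrid B}) (l : forall i, rel (B i)).
Variables (D : {set prodgrid (btail B)}) (c q : nat).
Arguments l : clear implicits.
Hypothesis ltt : forall i, total (l i) /\ transitive (l i).
Hypothesis dX : forall p q, prod_rel l p q -> q \in X -> p \in X.
Hypothesis cD : downset_complexity s2 D.
Hypothesis boundE : forall (I : {set B ord0}) D',
  downset_complexity s2.+2 D' -> kbox_free k (slab B I D' :&: E) ->
  #|slab B I D' :&: E| <= c * #|D'| + q * #|I|.

Let Y (h : B ord0) := [set a : prodgrid (btail B) | (h, a) \in X].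

Lemma fiber_decr h h' : l ord0 h h' -> Y h' \subset Y h.
Proof.
move=> lh; apply/subsetP=> a; rewrite !inE; apply: dX => /=.
by rewrite lh prod_rel_refl // => i; have [] := ltt (lift ord0 i).
Qed.

(* The fibers Y h decrease with h.  A node of the recursion keeps the points
   whose threshold falls in the window u; since only the nearest thresholds L
   and U on either side of u matter, the restriction to a node costs two
   downsets of dimension r, whatever the depth. *)
Lemma dyadic_split_bound N (u : seq (B ord0)) (L U : {set prodgrid (btail B)}) :
  uniq u -> pairwise (l ord0) u -> size u <= 2 ^ N ->
  is_downset L -> is_downset U ->
  (forall h, h \in u -> Y h \subset L) ->
  (forall h, h \in u -> ~: Y h \subset U) ->
  kbox_free k (slab B [set x in u] (D :&: L :&: U) :&: (E :&: X)) ->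
  #|slab B [set x in u] (D :&: L :&: U) :&: (E :&: X)|
    <= N * (c * #|D :&: L :&: U| + q * size u) + #|D :&: L :&: U|.
Proof.
elim: N u L U => [|N IH] u L U uu pu su dL dU YL YU fA.
  (* A window of at most one point contributes at most one copy of the base; this is the additive
     term of the bound. *)
  rewrite mul0n add0n; apply: leq_trans (subset_leq_card (subsetIl _ _)) _.
  rewrite card_slab -[leqRHS]mul1n leq_mul2r; apply/orP; right.
  rewrite cardsE; exact: leq_trans (card_size u) su.
have [su'|lt_u] := leqP (size u) (2 ^ N).
  by apply: leq_trans (IH _ _ _ uu pu su' dL dU YL YU fA) _; rewrite mulSn; lia.
have s1 : size (take (2 ^ N) u) = 2 ^ N by rewrite size_takel // ltnW.
have s2' : size (drop (2 ^ N) u) <= 2 ^ N.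
  by rewrite size_drop leq_subLR addnn -mul2n -expnS.
move: uu pu YL YU fA; rewrite -(cat_take_drop (2 ^ N) u).
(* The first half has exactly [2 ^ N] elements, so it is nonempty and its last element [h] can serve
   as pivot. *)
case/lastP: (take _ u) s1 => [|v h] s1.
  by have := expn_gt0 2 N; rewrite -s1.
move: (drop _ u) s2' => u2 s2'; set u1 := rcons v h in s1 *.
rewrite cat_uniq pairwise_cat => /and3P[uu1 _ uu2] /and3P[/allrelP a12 pu1 pu2].
move=> YL YU fA.
have hu1 : h \in u1 by rewrite mem_rcons mem_head.
have lh1 x : x \in u1 -> l ord0 x h.
  rewrite mem_rcons inE => /predU1P[->|xv].
    by have [tot _] := ltt ord0; have := tot h h; rewrite orbb.
  by move: pu1; rewrite pairwise_rcons => /andP[/allP av _]; apply: av.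
have lh2 x : x \in u2 -> l ord0 h x by move=> xu; apply: a12.
have YhL : Y h \subset L by apply: YL; rewrite mem_cat hu1.
have YhU : ~: Y h \subset U by apply: YU; rewrite mem_cat hu1.
have dY : is_downset (Y h) by apply: is_downset_fiber ltt dX.
(* Cutting by [Y h] replaces [L] on one side and [U] on the other, because [Y h] lies in [L] and its
   complement in [U]. Hence two thresholds always suffice. *)
have DY : (D :&: L :&: U) :&: Y h = D :&: Y h :&: U.
  by rewrite -setIA (setIC U) setIA -(setIA D) (setIidPr YhL).
have DnY : (D :&: L :&: U) :\: Y h = D :&: L :&: ~: Y h.
  by rewrite setDE -setIA (setIidPr YhU).
have sDY : D :&: Y h :&: U \subset D :&: L :&: U by rewrite -DY subsetIl.
have sDnY : D :&: L :&: ~: Y h \subset D :&: L :&: U by rewrite -DnY subsetDl.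
have memE (w : seq (B ord0)) D' (Z : {set prodgrid B}) p :
    p \in slab B [set x in w] D' :&: Z = [&& p.1 \in w, p.2 \in D' & p \in Z].
  by rewrite inE in_slab inE andbA.
have subA (w : seq (B ord0)) (D' : {set prodgrid (btail B)}) :
    {subset w <= u1 ++ u2} ->
    D' \subset D :&: L :&: U ->
    slab B [set x in w] D' :&: (E :&: X) \subset
    slab B [set x in u1 ++ u2] (D :&: L :&: U) :&: (E :&: X).
  move=> sw sD; apply/subsetP => p; rewrite !memE.
  move=> /and3P[/sw -> /(subsetP sD) ->].
  by [].
have s1u : {subset u1 <= u1 ++ u2} by move=> x xu; rewrite mem_cat xu.
have s2u : {subset u2 <= u1 ++ u2} by move=> x xu; rewrite mem_cat xu orbT.
have full (p : prodgrid B) : p.1 \in u1 -> p.2 \in Y h -> p \in X.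
  case: p => x a /= /lh1 /fiber_decr /subsetP sY /sY; by rewrite inE.
have empty (p : prodgrid B) : p.1 \in u2 -> p \in X -> p.2 \in Y h.
  case: p => x a /= /lh2 /fiber_decr /subsetP sY pX; apply: sY; by rewrite inE.
have b2 := IH u2 (Y h) U uu2 pu2 s2' dY dU.
have {}b2 := b2 (fun x xu => fiber_decr (lh2 x xu))
  (fun x xu => YU x (s2u x xu))
  (kbox_freeS (subA _ _ s2u sDY) fA).
have b1 := IH u1 L (~: Y h) uu1 pu1 _ dL (is_downset_setC dY).
have {}b1 := b1 (eq_leq s1) (fun x xu => YL x (s1u x xu)).
have {}b1 : #|slab B [set x in u1] (D :&: L :&: ~: Y h) :&: (E :&: X)|
    <= N * (c * #|D :&: L :&: ~: Y h| + q * size u1) + #|D :&: L :&: ~: Y h|.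
  apply: b1; last exact: (kbox_freeS (subA _ _ s1u sDnY) fA).
  by move=> x xu; rewrite setCS; apply/fiber_decr/lh1.
(* Here [X] holds automatically, so only [E] remains; the two downsets added to [D] are [Y h] and
   [U]. *)
have bF := boundE (I := [set x in u1])
  (downset_complexityI (downset_complexityI cD dY) dU).
have {}bF : #|slab B [set x in u1] (D :&: Y h :&: U) :&: E|
    <= c * #|D :&: Y h :&: U| + q * size u1.
  apply: leq_trans (bF _) _; last first.
    by rewrite leq_add2l leq_mul2l cardsE card_size orbT.
  apply: kbox_freeS (subset_trans _ (subA _ _ s1u sDY)) fA.
  apply/subsetP => p; rewrite !memE => /and3P[pu1' pD pE].
  rewrite pu1' pD inE pE /=; apply: full => //.
  by move: pD; rewrite !inE => /andP[/andP[_ ->]].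
have cover : slab B [set x in u1 ++ u2] (D :&: L :&: U) :&: (E :&: X) \subset
    (slab B [set x in u1] (D :&: Y h :&: U) :&: E) :|:
    ((slab B [set x in u1] (D :&: L :&: ~: Y h) :&: (E :&: X)) :|:
     (slab B [set x in u2] (D :&: Y h :&: U) :&: (E :&: X))).
  apply/subsetP => p; rewrite !inE.
  have := full p; have := empty p; rewrite !inE mem_cat.
  have := subsetP YhL p.2; have := subsetP YhU p.2; rewrite !inE.
  by do ![case: (_ \in _)] => //=; intuition.
apply: leq_trans (subset_leq_card cover) _.
apply: leq_trans (leq_card_setU _ _) _.
apply: leq_trans (leq_add (leqnn _) (leq_card_setU _ _)) _.
apply: leq_trans (leq_add bF (leq_add b1 b2)) _.
(* The recursive pieces have complementary bases and complementary windows, so their bounds add up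
   without doubling. The full piece pays for one more level. *)
rewrite -(cardsID (Y h) (D :&: L :&: U)) DY DnY size_cat.
nia.
Qed.
End DyadicSplit.

(** * Induction on the dimension *)

Lemma exists_subset_card (T : finType) (A : {set T}) k :
  k <= #|A| -> exists2 C : {set T}, C \subset A & #|C| = k.
Proof.
move=> /card_geqP[t [ut st tA]]; exists [set x in t].
  by apply/subsetP => x; rewrite inE => /tA.
by rewrite cardsE; move/card_uniqP: ut => ->.
Qed.

(** [L] stands for the logarithm, which keeps the induction within natural numbers; [c] is fixed
    before the grid and [L]. *)
Definition codim1_bound k r : Prop :=
  forall s, exists c, forall (B : 'I_r -> finType) L,
  0 < L -> (forall i, #|B i| <= 2 ^ L) ->
  forall A : {set prodgrid B}, downset_complexity s A -> kbox_free k A ->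
  #|A| <= c * codim1_sum B * L ^ (s * (2 ^ (r - 1) - 1)).

(** Induction on [s1]. Trading one constraint for two on [D] preserves [s2 + 2 * s1], so the power
    of [L] inherited from dimension [r] is known from the start, and each trade costs one further
    factor [L]. *)
Lemma slab_bound k r : codim1_bound k r ->
  forall s1 s2, exists c, forall (B : 'I_r.+1 -> finType) L,
  0 < L -> (forall i, #|B i| <= 2 ^ L) ->
  forall I (D : {set prodgrid (btail B)}) E,
  downset_complexity s2 D -> downset_complexity s1 E ->
  kbox_free k (slab B I D :&: E) ->
  #|slab B I D :&: E| <=
    c * (#|D| + codim1_sum (btail B)
                * L ^ ((s2 + 2 * s1) * (2 ^ (r - 1) - 1)) * #|I|)
    * L ^ s1.
Proof.
move=> IHr; elim=> [|s1 IH] s2.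
  have [c cP] := IHr s2.
  (* [k] serves the case of a small [I], [c] the bound for [D] in dimension [r]. *)
  exists (maxn k c) => B L L0 bB I D E cD -> fA.
  rewrite setIT card_slab muln0 addn0 expn0 muln1.
  have [Ik|kI] := ltnP #|I| k.
    rewrite mulnDr; apply: leq_trans (leq_addr _ _).
    by rewrite leq_mul2r leq_max (ltnW Ik) orbT.
  have fD : kbox_free k D.
    move=> X bX; apply/negP => sXD.
    have [C sCI cC] := exists_subset_card kI.
    have /negP[] := fA (slab B C X)
      (ex_intro _ C (ex_intro _ X (And3 cC bX erefl))).
    rewrite setIT; apply/subsetP => p; rewrite !in_slab => /andP[pC pX].
    by rewrite (subsetP sCI) // (subsetP sXD).
  have := cP (btail B) L L0 (fun i => bB _) D cD fD.
  move: (_ ^ _) => M bD.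
  apply: leq_trans (leq_mul (leqnn _) bD) _.
  rewrite mulnDr -(mulnA c) mulnCA [#|I| * _]mulnC.
  by apply: leq_trans (leq_addl _ _); rewrite leq_mul2r leq_maxr orbT.
(* The extra unit in [c.+1] absorbs the additive [#|D|] left by the bisection. *)
have [c cP] := IH s2.+2; exists c.+1 => B L L0 bB I D E cD.
case=> E' [X [cE' [l [tl dX]] ->]] fA.
have lI : #|I| <= 2 ^ L by apply: leq_trans (max_card _) (bB ord0).
set u := sort (l ord0) (enum I).
have uI : [set x in u] = I.
  by apply/setP => x; rewrite inE mem_sort mem_enum.
have szu : size u = #|I| by rewrite size_sort -cardE.
have [tot tr] := tl ord0.
have pu : pairwise (l ord0) u by rewrite -sorted_pairwise // sort_sorted.
have uu : uniq u by rewrite sort_uniq enum_uniq.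
have -> : s2 + 2 * s1.+1 = s2.+2 + 2 * s1 by lia.
set M := codim1_sum _ * _.
have bE' I' D' :
    downset_complexity s2.+2 D' -> kbox_free k (slab B I' D' :&: E') ->
    #|slab B I' D' :&: E'| <= (c * L ^ s1) * #|D'| + (c * M * L ^ s1) * #|I'|.
  move=> cD' fA'; apply: leq_trans (cP B L L0 bB I' D' E' cD' cE' fA') _.
  rewrite /M; apply: eq_leq; lia.
(* At the root no threshold has been passed, so both are the whole base; depth [L] suffices as
   [#|I| <= 2 ^ L]. *)
have dT := is_downset_setT (btail B).
have := @dyadic_split_bound r B k s2 X E' l D (c * L ^ s1) (c * M * L ^ s1)
  tl dX cD bE' L u setT setT uu pu.
rewrite !setIT szu uI => /(_ lI dT dT _ _ fA) b.
apply: leq_trans (b _ _) _; try by move=> h _; exact: subsetT.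
rewrite expnS.
have : 0 < L ^ s1 by rewrite expn_gt0 L0.
move: (L ^ s1) => P P0.
have -> : L * (c * P * #|D| + c * M * P * #|I|)
    = c * (#|D| + M * #|I|) * (L * P).
  by lia.
rewrite mulSn mulnDl addnC leq_add2r.
apply: leq_trans (leq_addr (M * #|I|) _) _.
by rewrite leq_pmulr // muln_gt0 L0.
Qed.

(** In dimension one, any set of size [k] is already a box. *)
Lemma card_line_lt_k k (B : 'I_1 -> finType) (A : {set prodgrid B}) :
  kbox_free k A -> #|A| < k.
Proof.
move=> fA; rewrite ltnNge; apply/negP => kA.
have [C sCA cC] := exists_subset_card kA.
have inj : {in C &, injective (fun p : prodgrid B => p.1)}.
  by move=> [x []] [y []] _ _ /= ->.
set C1 := [set p.1 | p : prodgrid B in C].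
have cC1 : #|C1| = k by rewrite card_in_imset.
have /negP[] := fA (slab B C1 setT)
  (ex_intro _ C1 (ex_intro _ setT (And3 cC1 erefl erefl))).
apply/subsetP => -[x []]; rewrite in_slab.
move=> /andP[/imsetP[[y []] /(subsetP sCA) yA /= ->] _].
exact: yA.
Qed.

Lemma codim1_bound_all k r : 0 < r -> codim1_bound k r.
Proof.
case: r => // r _; elim: r => [|r IH] s.
  exists k => B L L0 _ A _ /card_line_lt_k /ltnW.
  by rewrite /= card_unit muln0 addn0 subnn muln0 !muln1.
have [c cP] := slab_bound IH s 0; exists c => B L L0 bB A cA fA.
have := cP B L L0 bB setT setT A erefl cA.
have -> : slab B setT setT :&: A = A.
  by apply/setP => p; rewrite inE in_slab !inE.
move/(_ fA)/leq_trans; apply.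
rewrite !cardsT add0n !subSS !subn0.
(* The recursion for the exponent, checked on its closed form. *)
have -> : s * (2 ^ r.+1 - 1) = 2 * s * (2 ^ r - 1) + s.
  have := expn_gt0 2 r; rewrite expnS; nia.
rewrite expnD mulnA leq_mul2r; apply/orP; right.
rewrite -[leqRHS]mulnA leq_mul2l; apply/orP; right; rewrite /= mulnDl.
have : 0 < L ^ (2 * s * (2 ^ r - 1)) by rewrite expn_gt0 L0.
move: (L ^ _) => P P0; nia.
Qed.

(** * From dependent functions to nested pairs *)

Fixpoint to_prodgrid r : forall B : 'I_r -> finType,
    (forall i, B i) -> prodgrid B :=
  match r with
  | 0 => fun _ _ => tt
  | r'.+1 => fun B x =>
      (x ord0, @to_prodgrid r' (btail B) (fun i => x (lift ord0 i)))
  end.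

Lemma to_prodgrid_inj r (B : 'I_r -> finType) (x y : forall i, B i) :
  to_prodgrid x = to_prodgrid y -> forall i, x i = y i.
Proof.
elim: r B x y => [|r IH] B x y; first by move=> _ [].
case=> xy0 /IH xyS i; case: (unliftP ord0 i) => [j|] ->; last exact: xy0.
exact: xyS.
Qed.

Lemma prod_rel_to_prodgrid r (B : 'I_r -> finType) (l : forall i, rel (B i))
    (x y : forall i, B i) :
  prod_rel l (to_prodgrid x) (to_prodgrid y) <-> forall i, l i (x i) (y i).
Proof.
elim: r B l x y => [|r IH] B l x y; first by split=> // _ [].
split=> [/andP[l0 /IH lS] i|lxy /=].
  by case: (unliftP ord0 i) => [j|] -> //; apply: lS.
by rewrite lxy /=; apply/IH => i; apply: lxy.
Qed.

(** A dependent cons, which assembles the sides of a box from its first side and those of its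
    tail. *)
Definition dep_cons r (P : 'I_r.+1 -> Type) (x : P ord0)
    (f : forall j, P (lift ord0 j)) (i : 'I_r.+1) : P i :=
  match unliftP ord0 i with
  | UnliftSome j e => ecast z (P z) (esym e) (f j)
  | UnliftNone e => ecast z (P z) (esym e) x
  end.

Lemma dep_cons0 r (P : 'I_r.+1 -> Type) x f : @dep_cons r P x f ord0 = x.
Proof.
rewrite /dep_cons; case: unliftP => [j e|e]; first by [].
by rewrite (eq_axiomK e).
Qed.

Lemma dep_consS r (P : 'I_r.+1 -> Type) x f j :
  @dep_cons r P x f (lift ord0 j) = f j.
Proof.
rewrite /dep_cons; case: unliftP => [j' e|e]; last by [].
have ejj := lift_inj e; case: j' / ejj e => e.
by rewrite (eq_axiomK e).
Qed.

Lemma is_kbox_sides k r (B : 'I_r -> finType) (X : {set prodgrid B}) :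
  is_kbox k X -> exists C : forall i, {set B i},
    (forall i, #|C i| = k) /\
    (forall x : forall i, B i, (forall i, x i \in C i) -> to_prodgrid x \in X).
Proof.
elim: r B X => [|r IH] B X /=.
  move=> ->; exists (fun i => set0); split=> [i|x _]; first by case: i.
  by rewrite in_setT.
case=> C0 [X' [cC0 /IH[C [cC CX]] ->]].
pose P i := {set B i}.
exists (@dep_cons r P C0 C); split=> [i|x xC].
  case: (unliftP ord0 i) => [j|] ->.
    by rewrite (@dep_consS r P C0 C j) (cC j).
  by rewrite (@dep_cons0 r P C0 C) cC0.
rewrite in_slab /=; apply/andP; split.
  by have := xC ord0; rewrite (@dep_cons0 r P C0 C).
by apply: CX => i; have := xC (lift ord0 i); rewrite (@dep_consS r P C0 C i).
Qed.

(** * Comparison with [delta] *)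

Lemma card_prodgrid r (B : 'I_r -> finType) : #|prodgrid B| = \prod_i #|B i|.
Proof.
elim: r B => [|r IH] B; first by rewrite big_ord0 card_unit.
by rewrite big_ord_recl /= card_prod IH.
Qed.

Lemma codim1_sumE r (B : 'I_r -> finType) :
  codim1_sum B = \sum_i \prod_(j | j != i) #|B j|.
Proof.
elim: r B => [|r IH] B; first by rewrite big_ord0.
rewrite big_ord_recl /= card_prodgrid IH; congr (_ + _).
  by rewrite [RHS]big_mkcond big_ord_recl /= mul1n.
rewrite big_distrr; apply: eq_bigr => i _ /=.
rewrite [RHS]big_mkcond big_ord_recl /= [in LHS]big_mkcond /=; congr (_ * _).
Qed.

(** Complements of singletons have size [r - 1]. The inequality is strict for [r = 0], where [r - 1]
    truncates to [0] and the empty set contributes 1. *)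
Lemma codim1_sum_le_delta r (B : 'I_r -> finType) :
  codim1_sum B <= delta B (r - 1).
Proof.
have injC : injective (fun i : 'I_r => ~: [set i]).
  by move=> i j /setC_inj /set1_inj.
rewrite codim1_sumE /delta.
rewrite (bigID (mem [set ~: [set i] | i : 'I_r])) /=.
apply: leq_trans (leq_addr _ _).
rewrite (eq_bigl (mem [set ~: [set i] | i : 'I_r])); last first.
  move=> I /=; apply: andb_idl => /imsetP[i _ ->].
  by rewrite cardsC1 card_ord subn1.
rewrite big_imset /=; last by move=> i j _ _; apply: injC.
by apply: eq_leq; apply: eq_bigr => i _; apply: eq_bigl => j; rewrite !inE.
Qed.

(** The product omitting some index other than [i] has [#|B i|] as a factor, and its other factors
    are positive. *)
Lemma card_le_delta r (B : 'I_r -> finType) i :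
  1 < r -> (forall j, 0 < #|B j|) -> #|B i| <= delta B (r - 1).
Proof.
move=> r1 B0; apply: leq_trans (codim1_sum_le_delta B); rewrite codim1_sumE.
have [j ij] : exists j, i != j.
  have : 0 < #|~: [set i]| by rewrite cardsC1 card_ord -subn1 subn_gt0.
  by case/card_gt0P => j; rewrite !inE eq_sym; exists j.
rewrite (bigD1 j) //=; apply: leq_trans (leq_addr _ _).
rewrite (bigD1 i) //= leq_pmulr //.
by apply: prodn_gt0.
Qed.

(** * Basic sets as downsets *)

Section Transfer.
Variables (r : nat) (B : 'I_r -> finType).

Definition update (x : grid B) (i : 'I_r) (b : B i) : grid B :=
  oplus ([ffun j : {j | j != i} => x (val j)] : grid_del B i) b.

Lemma update_same (x : grid B) i b : @update x i b i = b.
Proof. exact: oplus_same. Qed.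

Lemma update_other (x : grid B) i b j : j != i -> @update x i b j = x j.
Proof. by move=> ji; rewrite (oplus_other _ _ (exist _ j ji)) ffunE. Qed.

(** Pass from [y] to [x] one coordinate at a time through the hybrids [z m]. Each step changes a
    single coordinate, so monotonicity lets it be compared at [x0] instead. *)
Lemma coordwise_monotone_homo d (S : orderType d) (f : grid B -> S)
    (x0 x y : grid B) :
  coordwise_monotone f ->
  (forall i, (f (update x0 (x i)) <= f (update x0 (y i)))%O) -> (f x <= f y)%O.
Proof.
move=> mf lxy.
pose z m : grid B := [ffun i : 'I_r => if i < m then x i else y i].
have zr : z r = x by apply/ffunP => i; rewrite ffunE ltn_ord.
have z0 : z 0 = y by apply/ffunP => i; rewrite ffunE ltn0.
suff zle m : m <= r -> (f (z m) <= f (z 0))%O by rewrite -zr -z0; apply: zle.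
elim: m => // m IH lt_mr; apply: le_trans (IH (ltnW lt_mr)).
pose i := Ordinal lt_mr.
have -> : z m.+1 = update (z m) (x i).
  apply/ffunP => j; have [->|ji] := eqVneq j i.
    by rewrite update_same ffunE /= ltnSn.
  by rewrite update_other // !ffunE ltnS leq_eqVlt
    (negPf (ji : (j : nat) != m)).
have {2}-> : z m = update (z m) (y i).
  apply/ffunP => j; have [->|ji] := eqVneq j i.
    by rewrite update_same ffunE /= ltnn.
  by rewrite update_other.
exact: (proj1 (mf i _ _ _ _) (lxy i)).
Qed.

Lemma basic_downset (X : {set grid B}) (x0 : grid B) : basic X ->
  exists2 X' : {set prodgrid B}, is_downset X' &
    forall x : grid B, (to_prodgrid x \in X') = (x \in X).
Proof.
case=> d [S [f [l [mf ->]]]].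
pose le i : rel (B i) := fun b b' => (f (update x0 b) <= f (update x0 b'))%O.
have tle i : total (le i) /\ transitive (le i).
  by split=> [b b'|b b' b'']; [apply: le_total | apply: le_trans].
(* Taking the downward closure of the image of the basic set makes the downset property immediate;
   [coordwise_monotone_homo] shows that no new grid point enters. *)
exists [set p | [exists x : grid B,
                  (f x < l)%O && prod_rel le p (to_prodgrid x)]].
  exists le; split=> // p q lpq; rewrite !inE => /existsP[x /andP[fx lqx]].
  apply/existsP; exists x; rewrite fx /=.
  by apply: prod_rel_trans lpq lqx => i; have [] := tle i.
move=> x; rewrite !inE.
apply/existsP/idP => [[y /andP[fy /prod_rel_to_prodgrid lxy]]|fx].
  exact: le_lt_trans (coordwise_monotone_homo mf lxy) fy.
by exists x; rewrite fx prod_rel_refl // => i; have [] := tle i.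
Qed.

Lemma grid_complexity_downset s (A : {set grid B}) (x0 : grid B) :
  has_grid_complexity s A ->
  exists2 A' : {set prodgrid B}, downset_complexity s A' &
    forall x : grid B, (to_prodgrid x \in A') = (x \in A).
Proof.
case=> m [X [ms bX ->]].
suff [A' cA' A'E] : exists2 A' : {set prodgrid B}, downset_complexity m A' &
    forall x : grid B, (to_prodgrid x \in A') = (x \in \bigcap_(t < m) X t).
  by exists A' => //; apply: downset_complexity_leq cA'.
elim: m X bX {ms} => [|m IH] X bX.
  by exists setT => // x; rewrite big_ord0 !inE.
have [A' cA' A'E] := IH (fun t => X (widen_ord (leqnSn m) t)) (fun t => bX _).
have [X' dX' X'E] := basic_downset x0 (bX ord_max).
exists (A' :&: X'); first exact: downset_complexityI.
by move=> x; rewrite big_ord_recr /= !inE A'E X'E.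
Qed.

Lemma kbox_free_of_K_free k (A : {set grid B}) (A' : {set prodgrid B}) :
  (forall x : grid B, (to_prodgrid x \in A') = (x \in A)) ->
  K_free k A -> kbox_free k A'.
Proof.
move=> A'E fA X /is_kbox_sides[C [cC CX]]; apply/negP => sXA'.
apply: fA; exists C; split=> //; apply/subsetP => x /setXnP xC.
by rewrite -A'E; apply: (subsetP sXA'); apply: CX.
Qed.

Lemma card_to_prodgrid (A : {set grid B}) (A' : {set prodgrid B}) :
  (forall x : grid B, (to_prodgrid x \in A') = (x \in A)) -> #|A| <= #|A'|.
Proof.
move=> A'E.
have inj : injective (fun x : grid B => to_prodgrid x).
  by move=> x y /to_prodgrid_inj xy; apply/ffunP.
rewrite -(card_imset A inj); apply/subset_leq_card/subsetP.
move=> p /imsetP[x xA ->].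
by rewrite A'E.
Qed.

End Transfer.

(** * Passage to the natural logarithm and conclusion *)

Local Open Scope ring_scope.

(** The factor 2 arises because the truncated logarithm times [ln 2], and [ln 2] itself, are each at
    most [ln (n + 1)]. *)
Lemma trunc_log2_le_ln (R : realType) (n : nat) : (0 < n)%N ->
  (trunc_log 2 n).+1%:R <= 2 / ln 2 * ln (n%:R + 1) :> R.
Proof.
move=> n0.
have ln2 : 0 < ln 2 :> R by rewrite ln_gt0 // ltr1n.
have le2 : ln 2 <= ln (n%:R + 1) :> R.
  by rewrite ler_ln ?posrE ?natr1 ?ltr0n // ler_nat.
have lelog : (trunc_log 2 n)%:R * ln 2 <= ln (n%:R + 1) :> R.
  rewrite mulr_natl -lnXn ?ltr0n // -natrX.
  rewrite ler_ln ?posrE ?natr1 ?ltr0n ?expn_gt0 // ler_nat.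
  by apply: leq_trans (trunc_logP _ n0) _.
rewrite mulrAC ler_pdivlMr // -natr1 mulrDl mul1r mulr2n mulrDl mul1r.
exact: lerD.
Qed.

Theorem theorem2p15 (R : realType) :
  exists beta : nat -> nat -> nat,
    (forall r s : nat, (2 <= r)%N -> beta r s = (s * (2 ^ (r - 1) - 1))%N) /\
    (forall r s k : nat, (2 <= r)%N -> (2 <= k)%N ->
      exists alpha : R,
        forall (B : 'I_r -> finType) (A : {set grid B}),
          K_free k A -> has_grid_complexity s A ->
          #|A|%:R <= alpha * (delta B (r - 1))%:R
                     * ln ((delta B (r - 1))%:R + 1) ^+ beta r s).
Proof.
exists (fun r s => (s * (2 ^ (r - 1) - 1))%N); split=> // r s k r2 _.
have [c cP] := @codim1_bound_all k r (ltnW r2) s.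
set b := (s * _)%N.
exists (c%:R * (2 / ln 2) ^+ b) => B A fA cA.
set n := delta B (r - 1).
have ln2 : 0 < ln 2 :> R by rewrite ln_gt0 // ltr1n.
have lnn : 0 <= ln (n%:R + 1) :> R by rewrite ln_ge0 // lerDr.
(* A point of [A] provides the base point for the preorders and makes all factors nonempty. *)
have [A0|[x0 _]] := set_0Vmem A.
  by rewrite A0 cards0 !mulr_ge0 ?exprn_ge0 ?mulr_ge0 ?invr_ge0 ?ler0n // ltW.
have B0 j : (0 < #|B j|)%N by apply/card_gt0P; exists (x0 j).
have Bn j : (#|B j| <= n)%N by apply: card_le_delta.
have n0 : (0 < n)%N := leq_trans (B0 (Ordinal r2)) (Bn _).
(* The successor ensures both [0 < L] and [n < 2 ^ L]. *)
set L := (trunc_log 2 n).+1.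
have BL j : (#|B j| <= 2 ^ L)%N.
  by apply: leq_trans (Bn j) (ltnW (trunc_log_ltn _ _)).
have [A' cA' A'E] := grid_complexity_downset x0 cA.
have := cP B L (ltn0Sn _) BL A' cA' (kbox_free_of_K_free A'E fA).
move/(leq_trans (card_to_prodgrid A'E)) => leA.
have {}leA : (#|A| <= c * n * L ^ b)%N.
  apply: leq_trans leA _.
  by rewrite leq_mul2r leq_mul2l codim1_sum_le_delta !orbT.
apply: le_trans (_ : (c * n * L ^ b)%:R <= _); first by rewrite ler_nat.
rewrite !natrM natrX -[leRHS]mulrA mulrACA -exprMn.
rewrite ler_wpM2l ?mulr_ge0 ?ler0n // lerXn2r ?nnegrE ?ler0n //.
  by rewrite !mulr_ge0 // invr_ge0 ltW.
exact: trunc_log2_le_ln.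
Qed.
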